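(* For each integer $n\geq 2$, $\mathrm{srd}(K_n)=n-1$.
   Context: $K_n$ is the complete graph on $n$ vertices. An edge-coloring of $G$ is any map $c:E(G)\to[k]$ (adjacent edges may receive the same color). For distinct vertices $u,v$ of a connected graph $G$, a $u$-$v$-edge-cut is a set $F$ of edges such that $u$ and $v$ lie in different components of $G-F$; a minimum $u$-$v$-edge-cut is one of minimum size among these. A set of edges is rainbow if no two of its edges have the same color. An edge-colored connected graph is strong rainbow disconnected if for every two distinct vertices $u,v$ there is a $u$-$v$-edge-cut that is both rainbow and minimum; $\mathrm{srd}(G)$ is the smallest number of colors of an edge-coloring making $G$ strong rainbow disconnected. *)

(* Defs.v *)
From mathcomp Require Import all_boot.

Set Implicit Arguments.
Unset Strict Implicit.
Unset Printing Implicit Defensive.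

(* Finite simple graphs. *)
Record sgraph := SGraph {
  vertex :> finType;
  adj : rel vertex;
  adj_sym : symmetric adj;
  adj_irr : irreflexive adj
}.

Definition connected (G : sgraph) : bool :=
  [forall u : G, forall v : G, connect (@adj G) u v].

Definition edge_set (G : sgraph) : {set {set G}} :=
  [set [set x; y] | x in G, y in G & adj x y].

Definition edge (G : sgraph) := {e : {set G} | e \in edge_set G}.

(* Adjacency in G - F. *)
Definition adj_minus (G : sgraph) (F : {set edge G}) : rel G :=
  [rel x y | [exists e : edge G, (e \notin F) && (val e == [set x; y])]].

Definition edge_cut (G : sgraph) (u v : G) (F : {set edge G}) : bool :=
  ~~ connect (adj_minus F) u v.

Definition minimum_edge_cut (G : sgraph) (u v : G) (F : {set edge G}) : bool :=
  edge_cut u v F &&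
  [forall F' : {set edge G}, edge_cut u v F' ==> (#|F| <= #|F'|)].

(* Colorings need be neither proper nor surjective. *)
Definition edge_coloring (G : sgraph) (k : nat) := {ffun edge G -> 'I_k}.

Definition rainbow (G : sgraph) (k : nat) (c : edge_coloring G k)
    (F : {set edge G}) : bool :=
  [forall e in F, forall f in F, (c e == c f) ==> (e == f)].

Definition strong_rainbow_disconnected (G : sgraph) (k : nat)
    (c : edge_coloring G k) : bool :=
  connected G &&
  [forall u : G, forall v : G, (u != v) ==>
    [exists F : {set edge G}, rainbow c F && minimum_edge_cut u v F]].

Definition srd_colorable (G : sgraph) (k : nat) : bool :=
  [exists c : edge_coloring G k, strong_rainbow_disconnected c].

(* Giving all edges distinct colors always works. *)
Lemma srd_colorable_ex (G : sgraph) :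
  connected G -> exists k, srd_colorable G k.
Proof.
move=> cG; exists #|{: edge G}|; apply/existsP.
exists [ffun e => enum_rank e]; rewrite /strong_rainbow_disconnected cG /=.
apply/forallP=> u; apply/forallP=> v; apply/implyP=> neq_uv.
have cutT : edge_cut u v [set: edge G].
  apply/connectP=> -[[|x p] /=]; first by move=> _ E; rewrite E eqxx in neq_uv.
  by case/andP=> /existsP[e]; rewrite inE.
case: (arg_minnP (fun F : {set edge G} => #|F|) cutT) => F cutF minF.
apply/existsP; exists F; apply/andP; split.
  apply/forall_inP=> e _; apply/forall_inP=> f _; apply/implyP.
  by rewrite !ffunE => /eqP/enum_rank_inj ->.
by rewrite /minimum_edge_cut cutF; apply/forallP=> F'; apply/implyP/minF.
Qed.

Definition srd (G : sgraph) (cG : connected G) : nat :=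
  ex_minn (srd_colorable_ex cG).

Definition complete_adj (n : nat) : rel 'I_n := fun x y => x != y.

Lemma complete_adj_sym (n : nat) : symmetric (@complete_adj n).
Proof. by move=> x y; rewrite /complete_adj eq_sym. Qed.

Lemma complete_adj_irr (n : nat) : irreflexive (@complete_adj n).
Proof. by move=> x; rewrite /complete_adj eqxx. Qed.

Definition complete_graph (n : nat) : sgraph :=
  SGraph (@complete_adj_sym n) (@complete_adj_irr n).

Lemma complete_connected (n : nat) : connected (complete_graph n).
Proof.
apply/forallP=> u; apply/forallP=> v.
by have [->|neq_uv] := eqVneq u v; [exact: connect0 | exact: connect1].
Qed.

(* Main.v *)
Require Import Defs.
From mathcomp Require Import all_boot.

(**
The [n - 1] edge-disjoint paths [u - v] and [u - w - v] show that every
[u]-[v]-edge-cut of the complete graph has at least [n - 1] edges, so a rainbow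
cut needs [n - 1] colors.

Conversely it suffices that the stars of all vertices but one are rainbow: one
of any two vertices then has a rainbow star, which is a minimum cut. Label the
vertices by the residues mod [n - 1] and a point at infinity, give an edge
[{i, j}] the color [i + j] and an edge [{i, oo}] the color [2 i]. At a finite
vertex [i] the sums [i + j] with [j <> i] miss exactly [2 i], so its star is
rainbow; there is no parity condition because nothing is asked of the star of
[oo].
*)

Lemma rainbow_card {G : sgraph} {k} {c : edge_coloring G k} {F : {set edge G}} :
  rainbow c F -> #|F| <= k.
Proof.
move=> /forall_inP rF; rewrite -[k in _ <= k]card_ord.
have /card_in_imset <- : {in F &, injective c}; last exact: max_card.
by move=> e f eF fF /eqP cef; apply/eqP;
  move/forall_inP: (rF e eF) => /(_ f fF)/implyP->.
Qed.

Lemma adj_minus_sym {G : sgraph} (F : {set edge G}) : symmetric (adj_minus F).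
Proof. by move=> x y; rewrite /adj_minus /= setUC. Qed.

Lemma edge_cut_sym {G : sgraph} (u v : G) (F : {set edge G}) :
  edge_cut u v F = edge_cut v u F.
Proof. by congr negb; apply/sym_connect_sym/adj_minus_sym. Qed.

Definition star {G : sgraph} (u : G) : {set edge G} := [set e : edge G | u \in val e].

Lemma edge_cut_star {G : sgraph} {u v : G} : u != v -> edge_cut u v (star u).
Proof.
move=> neq_uv; apply/connectP=> -[[|x p] /=].
  by move=> _ E; rewrite E eqxx in neq_uv.
by case/andP=> /existsP[e /andP[+ /eqP ee]]; rewrite inE ee set21.
Qed.

Lemma edge_starP {G : sgraph} {u : G} {e : edge G} :
  e \in star u -> exists2 x, adj u x & val e = [set u; x].
Proof.
rewrite inE; case: e => e /= /imset2P[x y _]; rewrite inE => /andP[_ xy] ->.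
rewrite !inE => /orP[]/eqP->; first by exists y.
by exists x; rewrite 1?adj_sym // setUC.
Qed.

Lemma adj_minusI {G : sgraph} {F : {set edge G}} {x y : G} :
  adj x y -> [set x; y] \notin val @: F -> adj_minus F x y.
Proof.
move=> xy nF; have xyE : [set x; y] \in edge_set G.
  by apply/imset2P; exists x y; rewrite ?inE.
apply/existsP; exists (Sub [set x; y] xyE); rewrite eqxx andbT.
by apply: contra nF => /(imset_f val).
Qed.

Lemma complete_edge_cut_card {n} {u v : complete_graph n}
    {F : {set edge (complete_graph n)}} :
  u != v -> edge_cut u v F -> n - 1 <= #|F|.
Proof.
move=> neq_uv cutF.
(* The edge of [F] on the path through [w], the path being [u - v] for [w = v]. *)
pose f w := if [set u; w] \in val @: F then [set u; w] else [set w; v].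
have f_inj : {in [set~ u] &, injective f}.
  move=> w w'; rewrite !inE => wu w'u; rewrite /f.
  case: ifP => _; case: ifP => _ /setP E.
  - by have := E w; rewrite !inE eqxx orbT (negPf wu) /= => /esym/eqP.
  - by have := E u; rewrite !inE eqxx (negPf neq_uv) (eq_sym u w') (negPf w'u).
  - by have := E u; rewrite !inE eqxx (negPf neq_uv) (eq_sym u w) (negPf wu).
  - have := E w; rewrite !inE eqxx /= => /esym/orP[/eqP//|/eqP wv].
    by have := E w'; rewrite !inE eqxx wv orbb /= => /eqP.
have f_sub : f @: [set~ u] \subset val @: F.
  apply/subsetP=> _ /imsetP[w + ->]; rewrite !inE /f => wu.
  case: ifPn => // uwF; apply: contraNT cutF => wvF.
  (* With both edges outside [F] the path through [w] survives. For [w = v], where [f v] would be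
     the non-edge [[set v; v]], the edge [u - v] alone connects. *)
  have uw : connect (adj_minus F) u w.
    by apply/connect1/adj_minusI; rewrite //= /complete_adj eq_sym.
  have [<-//|wv] := eqVneq w v.
  by apply: connect_trans uw _; apply/connect1/adj_minusI.
have /eqP := cardsC1 u; rewrite [#|vertex _|]card_ord -subn1 => /eqP <-.
rewrite -(card_in_imset f_inj) (leq_trans (subset_leq_card f_sub)) //.
exact: leq_imset_card.
Qed.

(* The last vertex plays the role of [oo]; being [0] mod [m.+1], it does not
   contribute to the sum. *)
Definition sum_coloring m : edge_coloring (complete_graph m.+2) m.+1 :=
  [ffun e : edge (complete_graph m.+2) =>
    inord (((if ord_max \in val e then 2 else 1) *
            \sum_(i in val e) nat_of_ord i) %% m.+1)].

(** From a finite [u], [ord_max] acts as a copy of [u], so colors on the star of [u] can be compared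
    by cancelling [u] mod [m.+1]. *)
Lemma sum_coloring_edge {m} {u x : 'I_m.+2} {e : edge (complete_graph m.+2)} :
  u != ord_max -> u != x -> val e = [set u; x] ->
  sum_coloring m e = (u + (if x == ord_max then u else x)) %% m.+1 :> nat.
Proof.
move=> u_fin ux ee; rewrite ffunE inordK ?ltn_pmod // ee.
rewrite big_setU1 /= ?in_set1 //.
rewrite big_set1 !inE eq_sym (negPf u_fin) eq_sym.
by case: eqP => [->|_]; rewrite ?mul1n // -modnMmr modnDr modnMmr mul2n addnn.
Qed.

Lemma rainbow_sum_coloring_star m (u : complete_graph m.+2) :
  u != ord_max -> rainbow (sum_coloring m) (star u).
Proof.
move=> u_fin; apply/forall_inP=> e /edge_starP[x ux ee].
apply/forall_inP=> f /edge_starP[y uy ef]; apply/implyP=> /eqP/(congr1 val) /=.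
(* Both summands lie below [m.+1], so their congruence is an equality. *)
have fin_lt (z : 'I_m.+2) : (if z == ord_max then u : 'I__ else z) < m.+1.
  have : (if z == ord_max then u : 'I__ else z) != ord_max by case: ifPn.
  by rewrite -val_eqE /= => z_fin; rewrite ltn_neqAle -ltnS ltn_ord andbT.
rewrite (sum_coloring_edge u_fin ux ee) (sum_coloring_edge u_fin uy ef).
move/eqP; rewrite eqn_modDl (modn_small (fin_lt x)) (modn_small (fin_lt y)).
move=> /eqP/val_inj E; apply/eqP/val_inj; rewrite ee ef; congr [set u; _]; move: E.
(* If just one of [x], [y] is [ord_max], the other equals [u], against adjacency. *)
case: eqP => [->|_]; case: eqP => [->|_] // E.
  by rewrite /= /complete_adj E eqxx in uy.
by rewrite /= /complete_adj E eqxx in ux.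
Qed.

Theorem theorem3p6 (n : nat) (hn : 2 <= n) :
  srd (complete_connected n) = n - 1.
Proof.
case: n hn => [|[|m]] // _; rewrite /srd; case: ex_minnP => k colk mink.
apply/eqP; rewrite eqn_leq; apply/andP; split.
  rewrite subn1; apply: mink; apply/existsP; exists (sum_coloring m).
  rewrite /strong_rainbow_disconnected complete_connected.
  apply/forallP=> u; apply/forallP=> v; apply/implyP=> neq_uv.
  have [w w_fin cut_w] : exists2 w : complete_graph m.+2,
      w != ord_max & edge_cut u v (star w).
    have [uoo|u_fin] := eqVneq u (ord_max : 'I_m.+2);
      last by exists u; rewrite ?edge_cut_star.
    by exists v; rewrite -?uoo 1?edge_cut_sym ?edge_cut_star // eq_sym.
  have rw := @rainbow_sum_coloring_star m w w_fin.
  apply/existsP; exists (star w); rewrite rw /minimum_edge_cut cut_w.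
  (* The star need not be counted: being rainbow in [m.+1] colors, it has at most [m.+1] edges, the
     lower bound for every cut. *)
  apply/forallP=> F; apply/implyP=> /(complete_edge_cut_card neq_uv).
  by rewrite subn1; apply/leq_trans/rainbow_card/rw.
have neq0oo : (ord0 : complete_graph m.+2) != ord_max by [].
case/existsP: colk => c /andP[_ /forallP/(_ ord0)/forallP/(_ ord_max)].
rewrite neq0oo => /existsP[F /and3P[/rainbow_card leFk cutF _]].
exact: leq_trans (complete_edge_cut_card neq0oo cutF) leFk.
Qed.
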